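(* For $f\in l^1(\mathbb{Z})$, a real number $C>1$ and a natural number $N$, let $$K_{C,N}=K_{C,N}(f):=\Big\{n\in\mathbb{Z}:\ |n|\leq N,\ \mathcal{F}f(n)\leq \frac{|n|}{C}\Big\},$$ where $\mathcal{F}f$ is the discrete frequency function of $f$. (i) For every $f\in l^1(\mathbb{Z})$ that is not identically zero and every real $C>1$, $$\lim_{N\to\infty}\frac{|K_{C,N}(f)|}{N}=0 .$$ (ii) In (i) one cannot replace the denominator $N$ by $N^{1-\epsilon}$ for any $\epsilon>0$, or even by $N/\log^{1+\epsilon}N$; that is, for every real $C>1$ and every $\epsilon>0$ there exists $f\in l^1(\mathbb{Z})$, not identically zero, such that $|K_{C,N}(f)|/N^{1-\epsilon}$ does not converge to $0$ as $N\to\infty$, and there exists $f\in l^1(\mathbb{Z})$, not identically zero, such that $|K_{C,N}(f)|\log^{1+\epsilon}N/N$ does not converge to $0$ as $N\to\infty$.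
   Context: $\mathbb{Z}^+$ denotes the set of non-negative integers (including $0$). $l^1(\mathbb{Z})$ is the space of absolutely summable (real- or complex-valued) functions on $\mathbb{Z}$. $|K|$ denotes the cardinality of a finite set $K$, and $\log^{a}N=(\log N)^{a}$. For $f\in l^1(\mathbb{Z})$, $n\in\mathbb{Z}$ and $r\in\mathbb{Z}^+$ put $$\mathcal{A}_rf(n):=\frac{1}{2r+1}\sum_{k=-r}^{r}|f(n+k)|,\qquad \mathcal{M}f(n):=\sup_{r\in\mathbb{Z}^+}\mathcal{A}_rf(n),$$ $$E_{f,n}:=\{r\in\mathbb{Z}^+:\ \mathcal{M}f(n)=\mathcal{A}_rf(n)\}.$$ The set $E_{f,n}$ is always non-empty, and the discrete frequency function is $\mathcal{F}f(n):=\inf E_{f,n}$, i.e. the smallest $r\in\mathbb{Z}^+$ for which the supremum defining $\mathcal{M}f(n)$ is attained. *)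

(* Defs.v *)
From HB Require Import structures.
From mathcomp Require Import all_boot all_order all_algebra.
From mathcomp Require Import finmap complex.
From mathcomp Require Import zify.
From mathcomp Require Import all_classical all_reals all_analysis.

Set Implicit Arguments.
Unset Strict Implicit.
Unset Printing Implicit Defensive.

Import Order.TTheory GRing.Theory Num.Theory.
Import numFieldNormedType.Exports.

Local Open Scope classical_set_scope.
Local Open Scope ring_scope.

Variant scalar_kind := RealScalars | ComplexScalars.

(* [Rcomplex R] is [R[i]] with its [R]-valued modulus; the norm of [R[i]]
   itself takes its values in [R[i]]. *)
Definition scalars (R : realType) (k : scalar_kind) : normedZmodType R :=
  match k with
  | RealScalars => R
  | ComplexScalars => Rcomplex R
  end.

Section frequency_function.
Variables (R : realType) (V : normedZmodType R).
Implicit Types (f : int -> V) (n : int).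

Definition l1 f : Prop := summable [set: int] (fun n => `|f n|%:E).

(* The index k < 2r+1 stands for the shift k - r, which runs over [-r, r]. *)
Definition average f (r : nat) n : R :=
  (\sum_(k < (2 * r + 1)%N) `|f (n + (k%:Z - r%:Z))|) / (2 * r + 1)%:R.

(* The supremum is a genuine one on l1, where the averages are bounded. *)
Definition maximal f n : R := sup [set average f r n | r in [set: nat]].

Definition maximizing_radii f n : set nat :=
  [set r | maximal f n = average f r n].

(* The infimum is taken in R; it is attained since, for f in l1, the set of
   maximizing radii is a nonempty set of natural numbers. *)
Definition frequency f n : R := inf [set r%:R | r in maximizing_radii f n].

Definition low_frequency_set (C : R) (N : nat) f : set int :=
  [set n | `|n| <= N%:Z /\ frequency f n <= `|n|%:~R / C].

Lemma finite_low_frequency_set (C : R) (N : nat) f :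
  finite_set (low_frequency_set C N f).
Proof.
apply: (@sub_finite_set _ _ [set i%:Z - N%:Z | i in `I_(2 * N + 1)%N]).
  move=> n [nN _] /=; exists (absz (n + N%:Z)).
    by rewrite /=; lia.
  by lia.
exact/finite_image/finite_II.
Qed.

(* [fset_set] returns the empty set on infinite sets; this never happens here
   by [finite_low_frequency_set]. *)
Definition low_frequency_card (C : R) (N : nat) f : nat :=
  #|` fset_set (low_frequency_set C N f)|.

End frequency_function.

(* Main.v *)
(* (i) A fixed spike of [f] gives [M f n >= c / N] for [|n| <= N], [N] large. If
   [F f n <= |n| / C] and [|n| > N / m], then the ball realizing the maximal
   function at [n] has average at least [c / N] and stays at distance at least
   [(1 - 1/C) N / m] from [0]. A Vitali covering argument bounds the number of
   such [n] by [2 N / c] times a tail of the l1 norm of [f], which is [o(N)].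

   (ii) Let [|f(i)| = 1/i] on a set of positive integers whose reciprocals sum
   to at most [1/C], and [f = 0] elsewhere; up to [N], this set lies in [K_{C,N}].
   A union of sparse blocks [N_j, N_j + L_j) with [L_j / N_j ~ 2^-j] and
   [ln N_j >= 2^j] then serves for every [eps] and for both denominators. *)
Require Import Defs.
From HB Require Import structures.
From mathcomp Require Import all_boot all_order all_algebra.
From mathcomp Require Import finmap complex zify ring lra.
From mathcomp Require Import all_classical all_reals all_analysis.

Import Order.TTheory GRing.Theory Num.Theory.
Import numFieldNormedType.Exports.

Local Open Scope classical_set_scope.
Local Open Scope ring_scope.

(** * Finite sums of nonnegative functions *)

Section finite_sums.
Context {R : realType} {T : eqType}.
Variable g : T -> R.
Hypothesis g_ge0 : forall x, 0 <= g x.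
Implicit Types s t : seq T.

Lemma ler_sum_subset s t : uniq s -> {subset s <= t} ->
  \sum_(x <- s) g x <= \sum_(x <- t) g x.
Proof.
elim: s t => [|x s IH] t /= => [_ _|/andP[xs us] st].
  by rewrite big_nil sumr_ge0.
have xt : x \in t by apply: st; rewrite mem_head.
rewrite (perm_big _ (perm_to_rem xt)) !big_cons lerD2l.
apply: IH => // y ys.
have : y \in t by apply: st; rewrite in_cons ys orbT.
rewrite (perm_mem (perm_to_rem xt)) in_cons => /orP[/eqP yx|//].
by rewrite -yx ys in xs.
Qed.

(** Choose [t] whose sum is within [eps] of the supremum of all finite sums; a list [s] disjoint
    from [t] keeps [s ++ t] below that supremum. *)
Lemma small_tail_sum (B eps : R) : 0 < eps ->
  (forall s, uniq s -> \sum_(x <- s) g x <= B) ->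
  exists t, forall s, uniq s -> (forall x, x \in s -> x \notin t) ->
    \sum_(x <- s) g x <= eps.
Proof.
move=> eps0 gB.
pose E := [set \sum_(x <- s) g x | s in [set s | uniq s]].
have ubE : has_sup E.
  split; first by exists (\sum_(x <- [::]) g x); exists [::].
  by exists B => _ [s us <-]; exact: gB.
have [_ [t /= ut <-] tE] := sup_adherent eps0 ubE.
exists t => s us st.
have : \sum_(x <- s ++ t) g x <= sup E.
  apply: ub_le_sup; first exact: ubE.2.
  exists (s ++ t) => //=; rewrite cat_uniq us ut andbT /=.
  by apply/hasPn => x xt; apply/negP => /st; rewrite xt.
by rewrite big_cat /=; lra.
Qed.

End finite_sums.

(** * Integer balls and a Vitali covering argument *)

Lemma seq_argmax (T : eqType) (F : T -> nat) (s : seq T) : s != [::] ->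
  exists2 x, x \in s & {in s, forall y, (F y <= F x)%N}.
Proof.
elim: s => // x [_ _|y s /(_ isT) [z zs zmax] _].
  by exists x; rewrite ?mem_head // => y; rewrite inE => /eqP->.
have [xz|zx] := leqP (F x) (F z).
  exists z; first by rewrite in_cons zs orbT.
  by move=> w; rewrite in_cons => /orP[/eqP->|/zmax].
exists x; first exact: mem_head.
move=> w; rewrite in_cons => /orP[/eqP->//|/zmax wz].
exact: leq_trans wz (ltnW zx).
Qed.

(** Enumerated by the same shifts as in [average], so that averages become sums over duplicate-free
    lists. *)
Definition zball (n : int) (r : nat) : seq int :=
  [seq n + (k%:Z - r%:Z) | k <- iota 0 (2 * r + 1)].

Lemma zball_uniq n r : uniq (zball n r).
Proof. by rewrite map_inj_uniq ?iota_uniq// => i j; lia. Qed.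

Lemma size_zball n r : size (zball n r) = (2 * r + 1)%N.
Proof. by rewrite size_map size_iota. Qed.

Lemma mem_zball n r x : (x \in zball n r) = (`|x - n| <= r%:Z).
Proof.
apply/mapP/idP => [[k]|xr]; first by rewrite mem_iota => ? ->; lia.
by exists (absz (x - n + r%:Z)); rewrite ?mem_iota; lia.
Qed.

(* Greedy selection: remove a largest ball together with the centers it could
   share points with; at most [4 r + 1] centers go, [r] being its radius. *)
Lemma zball_covering {R : realType} (g : int -> R) (rad : int -> nat) (lam : R)
    (s : seq int) : 0 <= lam -> uniq s ->
  (forall n : int, n \in s ->
     lam * (2 * rad n + 1)%:R <= \sum_(x <- zball n (rad n)) g x) ->
  exists t, [/\ uniq t,
    forall x, x \in t -> exists2 n, n \in s & x \in zball n (rad n) &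
    lam * (size s)%:R <= 2 * \sum_(x <- t) g x].
Proof.
move=> lam0; have [m sm] := ubnP (size s).
elim: m s sm => // m IH s; rewrite ltnS => sm us gs.
have [->|s0] := eqVneq s [::].
  by exists [::]; split => //; rewrite big_nil !mulr0.
have [n ns nmax] := seq_argmax _ rad _ s0.
pose nbr := [pred x : int | x \in zball n (2 * rad n)].
have sE : (size s = size [seq x <- s | nbr x] + size [seq x <- s | ~~ nbr x])%N.
  by rewrite !size_filter count_predC.
have nbr_n : n \in [seq x <- s | nbr x].
  by rewrite mem_filter /= mem_zball ns; lia.
have nbr_gt0 : (0 < size [seq x <- s | nbr x])%N.
  by case: [seq x <- s | nbr x] nbr_n.
have nbr_le : (size [seq x <- s | nbr x] <= 2 * (2 * rad n) + 1)%N.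
  rewrite -(size_zball n); apply: uniq_leq_size; first exact: filter_uniq.
  by move=> x; rewrite mem_filter => /andP[].
have [|||t [ut tball tsum]] := IH [seq x <- s | ~~ nbr x].
- by lia.
- exact: filter_uniq.
- by move=> x; rewrite mem_filter => /andP[_ /gs].
exists (zball n (rad n) ++ t); split.
(* A remaining center lies farther than [2 * rad n] from [n] and has radius at most [rad n], so its
   ball misses that of [n]. *)
- rewrite cat_uniq zball_uniq ut andbT /=; apply/hasPn => x /tball[y].
  rewrite mem_filter /= !mem_zball => /andP[ny /nmax]; lia.
- move=> x; rewrite mem_cat => /orP[|/tball[y]]; first by exists n.
  by rewrite mem_filter => /andP[_ ys] ?; exists y.
have {gs}gn := gs n ns.
rewrite big_cat /= sE natrD mulrDr mulrDr lerD//.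
(* The factor 2 comes from [4 r + 1 <= 2 (2 r + 1)]. *)
apply: le_trans (_ : 2 * (lam * (2 * rad n + 1)%:R) <= _); last by lra.
rewrite mulrCA ler_wpM2l// -natrM ler_nat; lia.
Qed.

(** * Averages, maximizing radii and the frequency function *)

Section averages.
Context {R : realType} {V : normedZmodType R}.
Implicit Types (f : int -> V) (n : int).

(** Trades the extended-real sum, a supremum of finite sums, for a real bound on sums over lists. *)
Lemma l1P f : l1 f <->
  exists B : R, forall s : seq int, uniq s -> \sum_(x <- s) `|f x| <= B.
Proof.
have fE A : finite_set A -> (\sum_(x \in A) `|(`|f x|%:E)|%E)%E
    = (\sum_(x <- fset_set A) `|f x|)%:E.
  move=> finA; rewrite fsbig_finite//= -sumEFin.
  by apply: eq_bigr => x _; rewrite normr_id.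
split=> [lf|[B fB]].
  have lf' : (\esum_(x in [set: int]) `|(`|f x|%:E)| \is a fin_num)%E.
    by rewrite -summableE.
  exists (fine (\esum_(x in [set: int]) `|(`|f x|%:E)|)%E) => s us.
  rewrite -lee_fin fineK//; apply: esum_ge; exists [set` s]; first by split=> //;
    exact: finite_seq.
  rewrite -fsbig_seq// -sumEFin; apply: lee_sum => x _.
  by rewrite /= normr_id.
rewrite /l1 /summable; apply: le_lt_trans (ltry B).
apply: ge_ereal_sup => _ [A [finA _] <-].
by rewrite fE// lee_fin fB// fset_uniq.
Qed.

Lemma averageE f r n :
  average f r n = (\sum_(x <- zball n r) `|f x|) / (2 * r + 1)%:R.
Proof.
rewrite /average big_map; congr (_ / _).
by rewrite -(big_mkord xpredT (fun k : nat => `|f (n + (k%:Z - r%:Z))|))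
  /index_iota subn0.
Qed.

Lemma average0 f n : average f 0 n = `|f n|.
Proof.
rewrite averageE /zball muln0 add0n big_seq1 divr1.
by rewrite (_ : n + _ = n)//; lia.
Qed.

Context {f : int -> V} {B : R}.
Hypothesis fB : forall s : seq int, uniq s -> \sum_(x <- s) `|f x| <= B.

Lemma average_le r n : average f r n <= B / (2 * r + 1)%:R.
Proof. by rewrite averageE ler_wpM2r ?invr_ge0// fB// zball_uniq. Qed.

Lemma has_ubound_average n : has_ubound [set average f r n | r in [set: nat]].
Proof.
exists B => _ [r _ <-]; apply: le_trans (average_le _ _) _.
have B0 : 0 <= B by have := fB [::] isT; rewrite big_nil.
by rewrite ler_pdivrMr ?ltr0n ?addn1// ler_peMr// ler1n.
Qed.

Lemma average_le_maximal r n : average f r n <= maximal f n.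
Proof. by apply: ub_le_sup; [exact: has_ubound_average|exists r]. Qed.

Lemma average_gt0 n : (exists x, f x != 0) -> exists r, 0 < average f r n.
Proof.
move=> [x fx]; exists (absz (x - n)).
rewrite averageE divr_gt0 ?ltr0n ?addn1//.
apply: lt_le_trans (_ : \sum_(y <- [:: x]) `|f y| <= _).
  by rewrite big_seq1 normr_gt0.
apply: ler_sum_subset => // y; rewrite inE => /eqP->.
by rewrite mem_zball abszE.
Qed.

(* The averages tend to [0], so only finitely many radii compete with one of
   positive average. *)
Lemma maximizing_radii_nonempty n : (exists x, f x != 0) ->
  maximizing_radii f n !=set0.
Proof.
move=> /(average_gt0 n) [r0 a0].
have B0 : 0 <= B by have := fB [::] isT; rewrite big_nil.
have [m Bm] : exists m : nat, B / average f r0 n < m%:R.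
  by exists (Num.bound (B / average f r0 n)); apply/archi_boundP/divr_ge0/ltW.
have large r : (m <= r)%N -> average f r n < average f r0 n.
  move=> mr; apply: le_lt_trans (average_le _ _) _.
  rewrite ltr_pdivrMr ?ltr0n ?addn1// mulrC -ltr_pdivrMr//.
  by apply: lt_le_trans Bm _; rewrite ler_nat; lia.
have r0m : (r0 < m)%N.
  by rewrite ltnNge; apply/negP => /large; rewrite ltxx.
have [/= r _ rmax] := @arg_maxP _ _ _ (Ordinal r0m) xpredT
  (fun i : 'I_m => average f i n) isT.
exists r; apply/eqP; rewrite eq_le average_le_maximal andbT.
apply: ge_sup; first by exists (average f r0 n), r0.
move=> _ [q _ <-]; have [qm|/large/ltW qr0] := ltnP q m.
  exact: (rmax (Ordinal qm) isT).
exact: le_trans qr0 (rmax (Ordinal r0m) isT).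
Qed.

(** A nonempty set of naturals has a least element, so the infimum is attained and a frequency bound
    yields an actual maximizing radius. *)
Lemma frequency_leP n (y : R) : (exists x, f x != 0) ->
  frequency f n <= y <-> exists2 r, maximizing_radii f n r & r%:R <= y.
Proof.
move=> /(maximizing_radii_nonempty n) ne; split=> [|[r rm ry]].
  have [r0 r0m] := ne.
  have ex : exists r, `[< maximizing_radii f n r >] by exists r0; exact/asboolP.
  case: (ex_minnP ex) => r /asboolP rm rmin; exists r => //.
  apply: le_trans _ _; last by eassumption.
  apply: lb_le_inf; first by exists r0%:R, r0.
  by move=> _ [q qm <-]; rewrite ler_nat; apply/rmin/asboolP.
apply: le_trans ry; apply: ge_inf; last by exists r.
by exists 0 => _ [q _ <-].
Qed.

End averages.

(** * Low frequencies have density zero *)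

Lemma exists_absz_bound (t : seq int) :
  exists M, forall x, x \in t -> (absz x <= M)%N.
Proof.
elim: t => [|x t [M tM]]; first by exists 0%N.
exists (maxn (absz x) M) => y; rewrite in_cons leq_max => /orP[/eqP->|/tM->].
  by rewrite leqnn.
by rewrite orbT.
Qed.

Section low_frequency.
Context {R : realType} {V : normedZmodType R}.
Implicit Types (f : int -> V) (C : R).

Lemma mem_low_frequency C N f n :
  (n \in fset_set (low_frequency_set C N f)) = (n \in low_frequency_set C N f).
Proof. by rewrite in_fset_set//; exact: finite_low_frequency_set. Qed.

Lemma low_frequency_card_ge C N f (s : seq int) : uniq s ->
  (forall n, n \in s -> low_frequency_set C N f n) ->
  (size s <= low_frequency_card C N f)%N.
Proof.
move=> us sN; apply: uniq_leq_size => // n /sN nN.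
by rewrite mem_low_frequency inE.
Qed.

(** The ball of radius [|n| + |x|] around [n] contains [x] and has at most [4 N + 1 <= 5 N]
    points. *)
Lemma maximal_ge f (x n : int) (N : nat) : l1 f -> (0 < N)%N ->
  (absz x <= N)%N -> (absz n <= N)%N -> `|f x| / (5 * N)%:R <= maximal f n.
Proof.
move=> /l1P[B fB] N0 xN nN.
apply: le_trans (average_le_maximal fB (absz n + absz x) n).
rewrite averageE ler_pM ?invr_ge0//.
  apply: le_trans (_ : \sum_(y <- [:: x]) `|f y| <= _).
    by rewrite big_seq1.
  apply: ler_sum_subset => // y; rewrite inE => /eqP->.
  by rewrite mem_zball; lia.
by rewrite lef_pV2 ?posrE ?ltr0n ?ler_nat; lia.
Qed.

Lemma low_frequency_card_cvg0 f C :
  l1 f -> (exists n, f n != 0) -> 1 < C ->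
  (low_frequency_card C N f)%:R / N%:R @[N --> \oo] --> (0 : R).
Proof.
move=> lf fn0 C1; have [x0 fx0] := fn0; have /l1P[B fB] := lf.
have C0 : 0 < C by lra.
have iC : 0 < 1 - C^-1 by rewrite subr_gt0 invf_lt1.
have c0 : 0 < `|f x0| by rewrite normr_gt0.
apply/cvgrPdist_le => eps eps0.
(* Points with [|n| <= N / m] number at most [2 N / m + 1], and [2 N / m < eps N / 4]. *)
have [m m_gt] : exists m : nat, 8 / eps < m%:R.
  by exists (Num.bound (8 / eps)); apply/archi_boundP/divr_ge0/ltW.
have m0 : 0 < m%:R :> R by apply: le_lt_trans m_gt; apply/divr_ge0/ltW.
(* With averages at least [|f x0| / (5 N)], this tail lets the covering bound the remaining points
   by [eps N / 4]. *)
have [t tE] := small_tail_sum (fun x => `|f x|) B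
  (eps * `|f x0| / 40) (divr_gt0 (mulr_gt0 eps0 c0) (ltr0Sn _ _)) fB.
have [M tM] := exists_absz_bound t.
(* For [N >= N1] the distance [(1 - 1/C) N / m] exceeds [M], hence clears [t]. *)
have [N1 N1_gt] : exists N1 : nat, M%:R * m%:R / (1 - C^-1) < N1%:R.
  exists (Num.bound (M%:R * m%:R / (1 - C^-1))); apply: archi_boundP.
  by apply/divr_ge0/ltW => //; apply: mulr_ge0.
exists (maxn (maxn (absz x0) N1) m) => // N /=.
rewrite !geq_max -andbA => /and3P[x0N N1N mN].
have N0 : (0 < N)%N by rewrite (leq_trans _ mN)// -(ltr0n R).
have NR0 : 0 < N%:R :> R by rewrite ltr0n.
rewrite sub0r normrN ger0_norm ?divr_ge0// ler_pdivrMr//.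
pose s := enum_fset (fset_set (low_frequency_set C N f)).
pose q := (N %/ m)%N.
have qN : (q%:R : R) * m%:R <= N%:R by rewrite -natrM ler_nat leq_trunc_div.
pose small := [pred n : int | (absz n <= q)%N].
have -> : low_frequency_card C N f
    = (size [seq n <- s | small n] + size [seq n <- s | ~~ small n])%N.
  by rewrite !size_filter count_predC.
have small_le : (size [seq n <- s | small n] <= 2 * q + 1)%N.
  rewrite -(size_zball 0); apply: uniq_leq_size.
    by rewrite filter_uniq// fset_uniq.
  by move=> n; rewrite mem_filter mem_zball subr0 -abszE lez_nat => /andP[].
(* Outside the low-frequency points the radius takes the dummy value 0. *)
have /choice[rad radP] n : exists r, frequency f n <= `|n|%:~R / C ->
    maximizing_radii f n r /\ r%:R <= `|n|%:~R / C :> R.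
  have [/(frequency_leP fB _ _ fn0)[r]|] :=
    pselect (frequency f n <= `|n|%:~R / C); first by exists r.
  by exists 0%N.
have sP n : n \in [seq n <- s | ~~ small n] ->
    [/\ (q < absz n)%N, (absz n <= N)%N, maximizing_radii f n (rad n) &
        (rad n)%:R <= (absz n)%:R / C :> R].
  rewrite mem_filter /= -ltnNge mem_low_frequency => /andP[qn].
  rewrite in_setE => -[nN /radP[rn rC]]; split => //.
pose lam : R := `|f x0| / (5 * N)%:R.
have [||n /sP[_ nN rn _]|t' [ut' t'ball t'sum]] := zball_covering
    (fun x => `|f x|) rad lam [seq n <- s | ~~ small n].
- by rewrite divr_ge0.
- by rewrite filter_uniq// fset_uniq.
- rewrite -ler_pdivlMr ?ltr0n ?addn1// -[(2 * _).+1]addn1 -averageE.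
  by rewrite -[X in _ <= X]rn; exact: maximal_ge.
(* For [x] in the ball of [n]: [|x| >= |n| - rad n >= (1 - 1/C) |n| > M], since [|n| > N / m]. *)
have t'M x : x \in t' -> x \notin t.
  move=> /t'ball[n /sP[qn _ _ rC]]; rewrite mem_zball => xn.
  apply/negP => /tM; rewrite leqNgt => /negP; apply.
  have : (absz n - rad n <= absz x)%N by move: xn; clear; lia.
  rewrite leq_subLR -(ler_nat R) natrD => nx.
  have Nmn : N%:R < m%:R * (absz n)%:R :> R.
    rewrite -natrM ltr_nat mulnC -ltn_divLR// -(ltr0n R)//.
  rewrite -(ltr_nat R).
  apply: lt_le_trans (_ : (1 - C^-1) * (absz n)%:R <= _); last first.
    by rewrite mulrBl mul1r lerBlDl mulrC (le_trans nx)// lerD2r.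
  rewrite mulrC -ltr_pdivrMr// -(ltr_pM2l m0); apply: lt_trans Nmn.
  rewrite mulrA [m%:R * _]mulrC; apply: lt_le_trans N1_gt _.
  by rewrite ler_nat.
have large_le : (size [seq n <- s | ~~ small n])%:R * 4 <= eps * N%:R.
  have := le_trans t'sum (ler_wpM2l (ler0n R 2) (tE _ ut' t'M)).
  rewrite -(ler_pM2l (_ : 0 < 20 * N%:R / `|f x0|)) ?divr_gt0 ?mulr_gt0//.
  rewrite /lam natrM; congr (_ <= _); field; rewrite ?gt_eqF//.
have q_le : q%:R * 8 <= eps * N%:R.
  rewrite [leRHS]mulrC; apply: le_trans (ler_wpM2r (ltW eps0) qN).
  rewrite -mulrA ler_wpM2l// ltW// -ltr_pdivrMr//.
have one_le : 8 <= eps * N%:R.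
  rewrite mulrC -ler_pdivrMr//; apply: le_trans (ltW m_gt) _.
  by rewrite ler_nat.
have small_leR : (size [seq n <- s | small n])%:R <= 2 * q%:R + 1 :> R.
  by rewrite -natrM natr1 ler_nat -addn1.
rewrite natrD; move: large_le q_le one_le small_leR; clear; lra.
Qed.

End low_frequency.

(** * Spikes of prescribed height *)

(** Lets one real construction serve both scalar kinds. *)
Lemma scalars_of_nonneg (R : realType) (k : scalar_kind) :
  exists e : R -> scalars R k, forall x, 0 <= x -> `|e x| = x.
Proof.
case: k; first by exists id => x /ger0_norm.
exists (fun x => (x%:C)%C : Rcomplex R) => x x0.
by rewrite /= /Num.norm /= expr0n addr0 sqrtr_sqr ger0_norm.
Qed.

(* A spike of height [1/i] beats every average over a radius exceeding [i/C],
   as the total mass is at most [1/C]. *)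
Lemma spikes {R : realType} {k : scalar_kind} (C : R) (S : pred nat) : 0 < C ->
  (exists i, S i && (0 < i)%N) ->
  (forall m, \sum_(i <- iota 0 m | S i) i%:R^-1 <= C^-1 :> R) ->
  exists f : int -> scalars R k, [/\ l1 f, exists n, f n != 0 &
    forall N i, S i -> (0 < i <= N)%N -> low_frequency_set C N f i%:Z].
Proof.
move=> C0 [i0 /andP[Si0 i00]] SC.
have [e eE] := scalars_of_nonneg R k.
(* At [i = 0] the convention [0^-1 = 0] makes the value 0. *)
pose g (n : int) : R := if n is Posz i then (S i)%:R / i%:R else 0.
have g0 n : 0 <= g n by case: n => // i; rewrite /g divr_ge0.
pose f n := e (g n).
have fE n : `|f n| = g n by rewrite /f eE.
have fB s : uniq s -> \sum_(x <- s) `|f x| <= C^-1.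
  move=> us; have [M sM] := exists_absz_bound s.
  apply: le_trans (SC M.+1).
  pose t := [seq Posz i | i <- iota 0 M.+1] ++ [seq Negz i | i <- iota 0 M.+1].
  apply: le_trans (_ : \sum_(x <- t) `|f x| <= _).
    apply: ler_sum_subset => // x /sM xM; rewrite mem_cat.
    case: x xM => i iM; apply/orP; [left|right]; apply: map_f;
      rewrite mem_iota; lia.
  rewrite big_cat !big_map /= [X in _ + X]big1 ?addr0; last first.
    by move=> i _; rewrite fE.
  rewrite [leRHS]big_mkcond; apply: ler_sum => i _.
  by rewrite fE /g; case: (S i); rewrite ?mul1r ?mul0r.
have fn0 : exists n, f n != 0.
  by exists i0%:Z; rewrite -normr_gt0 fE /g Si0 mul1r invr_gt0 ltr0n.
exists f; split => //; first by apply/l1P; exists C^-1.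
move=> N i Si /andP[i0' iN]; split; first by rewrite /= lez_nat.
apply/(frequency_leP fB _ _ fn0).
have [r rm] := maximizing_radii_nonempty fB i%:Z fn0.
exists r => //; rewrite leNgt; apply/negP => ir.
(* The radius 0 already averages to [1/i]. The resulting [C (2 r + 1) <= i] contradicts
   [i / C < r]. *)
have : i%:R^-1 <= C^-1 / (2 * r + 1)%:R :> R.
  apply: le_trans (average_le fB r i%:Z); rewrite -rm.
  apply: le_trans (average_le_maximal fB 0 i%:Z).
  by rewrite average0 fE /g Si mul1r.
have iR : 0 < i%:R :> R by rewrite ltr0n.
rewrite -invfM lef_pV2 ?posrE// ?mulr_gt0 ?ltr0n ?addn1//.
apply/negP; rewrite -ltNge; rewrite ltr_pdivrMr// in ir.
apply: lt_le_trans ir _; rewrite mulrC ler_pM2l// ler_nat; lia.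
Qed.

(** * Sparse blocks of spikes *)

Lemma geometric_sum_le1 {R : realFieldType} m :
  \sum_(j <- iota 0 m) (2 ^ j.+1)%:R^-1 <= 1 :> R.
Proof.
suff -> : \sum_(j <- iota 0 m) (2 ^ j.+1)%:R^-1 = 1 - (2 ^ m)%:R^-1 :> R.
  by rewrite gerBl invr_ge0.
elim: m => [|m IH]; first by rewrite big_nil invr1 subrr.
rewrite -addn1 iotaD big_cat /= IH big_seq1 add0n addn1 expnS natrM.
have : (2 ^ m)%:R != 0 :> R by rewrite pnatr_eq0 expn_eq0.
by move=> h; field.
Qed.

(** The bound [ln (1 + x) <= x] at [x = -1/2] gives [ln 2 >= 1/2]. Base 4 thus ensures
    [ln (block_length j) >= 2^j]. *)
Lemma ln4_ge1 {R : realType} : 1 <= ln 4 :> R.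
Proof.
have : ln (2^-1) <= - 2^-1 :> R.
  by have := @le_ln1Dx R (- 2^-1); rewrite (_ : 1 + - 2^-1 = 2^-1 :> R);
    [apply; lra|lra].
rewrite lnV ?posrE// (_ : 4 = 2 ^+ 2 :> R); last by ring.
by rewrite lnXn// => h; rewrite mulr2n; lra.
Qed.

Section blocks.
Variable D : nat.

(* The blocks have total mass [sum_j 1 / (D 2^(j+1)) = 1 / D]; doubly
   exponential lengths make [ln] of the position at least the inverse density [2^j]. *)
Definition block_length (j : nat) : nat := (4 ^ 2 ^ j)%N.
Definition block_start (j : nat) : nat := (D * 2 ^ j.+1 * block_length j)%N.
Definition in_block (j i : nat) : bool :=
  (block_start j <= i < block_start j + block_length j)%N.
Definition blocks : pred nat := fun i => has (in_block^~ i) (iota 0 i).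

Hypothesis D0 : (0 < D)%N.

Lemma block_length_le_start j : (block_length j <= block_start j)%N.
Proof. by rewrite leq_pmull// muln_gt0 D0 expn_gt0. Qed.

(** This is why the search in [blocks] may stop at [j < i]: a block containing [i] starts no later
    than [i]. *)
Lemma lt_block_start j : (j < block_start j)%N.
Proof.
apply: leq_trans (block_length_le_start j).
have := ltn_expl j (isT : (1 < 2)%N).
have := ltn_expl (2 ^ j) (isT : (1 < 4)%N).
by rewrite /block_length; lia.
Qed.

Lemma in_blocks j i : in_block j i -> blocks i.
Proof.
move=> ji; apply/hasP; exists j => //; rewrite mem_iota /=.
by move: ji => /andP[+ _]; have := lt_block_start j; lia.
Qed.

Lemma sum_blocks_le {R : realType} m :
  \sum_(i <- iota 0 m | blocks i) i%:R^-1 <= D%:R^-1 :> R.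
Proof.
have start0 j : 0 < (block_start j)%:R :> R.
  by rewrite ltr0n (leq_trans _ (lt_block_start j)).
pose w i j : R := if in_block j i then (block_start j)%:R^-1 else 0.
have w0 i j : 0 <= w i j by rewrite /w; case: ifP => // _; rewrite invr_ge0.
(* Union bound: each [1/i] is at most the inverse start of a block containing [i]. Exchanging sums,
   block [j] costs at most its length over its start, [1 / (D 2^(j+1))]. *)
apply: le_trans (_ : \sum_(i <- iota 0 m) \sum_(j <- iota 0 m) w i j <= _).
  rewrite big_mkcond big_seq [leRHS]big_seq; apply: ler_sum => i im.
  case: ifPn => [/hasP[j ji /= ij]|_]; last by apply: sumr_ge0.
  apply: le_trans (_ : \sum_(l <- [:: j]) w i l <= _).
    have si : (block_start j)%:R <= i%:R :> R by rewrite ler_nat; case/andP: ij.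
    by rewrite big_seq1 /w ij lef_pV2 ?posrE// (lt_le_trans (start0 j)).
  apply: ler_sum_subset => // l; rewrite inE => /eqP->.
  by move: ji im; rewrite !mem_iota; lia.
rewrite exchange_big /=.
apply: le_trans (_ : \sum_(j <- iota 0 m) D%:R^-1 * (2 ^ j.+1)%:R^-1 <= _).
  apply: ler_sum => j _; rewrite /w -big_mkcond -big_filter.
  apply: le_trans (_ : \sum_(i <- iota (block_start j) (block_length j))
      (block_start j)%:R^-1 <= _).
    apply: ler_sum_subset => [_||i]; first by rewrite invr_ge0.
      by rewrite filter_uniq// iota_uniq.
    by rewrite mem_filter => /andP[+ _]; rewrite mem_iota.
  rewrite big_const_seq count_predT size_iota iter_addr_0 -[leLHS]mulr_natr.
  have L0 : (block_length j)%:R != 0 :> R by rewrite pnatr_eq0 expn_eq0.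
  by rewrite /block_start natrM invfM -mulrA mulVf// mulr1 natrM invfM.
by rewrite -mulr_sumr ler_piMr ?invr_ge0// geometric_sum_le1.
Qed.

End blocks.

(** Take [N] twice the start of block [j]: the whole block lies below [N] and has [N / (4 D 2^j)]
    points, [D] being the block parameter. *)
Lemma many_low_frequency_points {R : realType} {k : scalar_kind} (C : R) :
  1 < C -> exists (f : int -> scalars R k) (D : nat),
  [/\ l1 f, exists n, f n != 0, (0 < D)%N &
    forall j, exists N, [/\ (j <= N)%N, 2 ^+ j <= ln (N%:R : R) &
      (N <= D * 2 ^ j * low_frequency_card C N f)%N]].
Proof.
move=> C1; have C0 : 0 < C by lra.
(* [D > C] keeps the total mass [1/D] within the budget [1/C] of [spikes]. *)
pose D := Num.bound C.
have CD : C < D%:R by apply/archi_boundP/ltW.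
have D0 : (0 < D)%N by rewrite -(ltr0n R); lra.
have [||f [lf fn0 fS]] := @spikes R k C (blocks D) C0.
- exists (block_start D 0); rewrite (in_blocks D D0 0) ?lt_block_start//.
  by rewrite /in_block leqnn /= -addn1 leq_add2l expn_gt0.
- move=> m; apply: le_trans (sum_blocks_le D D0 m) _.
  by rewrite lef_pV2 ?posrE ?ltr0n// ltW.
exists f, (4 * D)%N; split => //.
move=> j; exists (2 * block_start D j)%N; split.
- by have := lt_block_start D D0 j; lia.
- apply: le_trans (_ : ln ((block_length j)%:R : R) <= _).
    rewrite /block_length natrX lnXn// -[leRHS]mulr_natr natrX ler_peMl//.
    exact: ln4_ge1.
  rewrite ler_ln ?posrE ?ltr0n ?expn_gt0//.
    by rewrite ler_nat; have := block_length_le_start D D0 j; lia.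
  by have := lt_block_start D D0 j; lia.
have : (block_length j <= low_frequency_card C (2 * block_start D j) f)%N.
  have <- : size [seq i%:Z | i <- iota (block_start D j) (block_length j)]
      = block_length j by rewrite size_map size_iota.
  apply: low_frequency_card_ge.
    by rewrite map_inj_uniq ?iota_uniq// => x y [].
  move=> _ /mapP[i + ->]; rewrite mem_iota => ij; apply: fS.
    exact: (in_blocks D D0 j).
  have := block_length_le_start D D0 j; have := lt_block_start D D0 j; lia.
set c := low_frequency_card _ _ _ => Lc; rewrite /block_start expnS.
set L := block_length j in Lc *.
rewrite (_ : (2 * (D * (2 * 2 ^ j) * L) = 4 * D * 2 ^ j * L)%N); last by ring.
by rewrite leq_mul2l Lc orbT.
Qed.

(** * Non-convergence and conclusion *)

Lemma not_cvg0 {R : realType} (u : nat -> R) (c : R) : 0 < c ->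
  (forall j, exists2 N, (j <= N)%N & c <= u N) -> ~ (u @ \oo --> (0 : R)).
Proof.
move=> c0 uc /cvgrPdist_lt /(_ c c0) [j _ uj].
have [N jN cN] := uc j.
have /= := uj N jN; rewrite sub0r normrN => /(le_lt_trans (ler_norm _)).
by rewrite ltNge cN.
Qed.

Theorem theorem2 (R : realType) (k : scalar_kind) :
  (forall (f : int -> scalars R k) (C : R),
      l1 f -> (exists n, f n != 0) -> 1 < C ->
      (fun N : nat => (low_frequency_card C N f)%:R / N%:R : R) @ \oo --> (0 : R))
  /\
  (forall C eps : R, 1 < C -> 0 < eps ->
      (exists f : int -> scalars R k,
          [/\ l1 f, exists n, f n != 0 &
              ~ ((fun N : nat =>
                    (low_frequency_card C N f)%:R / N%:R `^ (1 - eps) : R)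
                   @ \oo --> (0 : R))])
      /\
      (exists f : int -> scalars R k,
          [/\ l1 f, exists n, f n != 0 &
              ~ ((fun N : nat =>
                    (low_frequency_card C N f)%:R * (ln N%:R) `^ (1 + eps) / N%:R : R)
                   @ \oo --> (0 : R))])).
Proof.
split=> [f C|C eps C1 eps0]; first exact: low_frequency_card_cvg0.
have [f [D [lf fn0 D0 fN]]] := @many_low_frequency_points R k C C1.
have DR : 0 < D%:R :> R by rewrite ltr0n.
have pow2 j : 0 < 2 ^+ j :> R by rewrite exprn_gt0.
have NP j : exists N, [/\ (j <= N)%N, 0 < N%:R :> R, 2 ^+ j <= ln (N%:R : R) &
    N%:R / (D%:R * 2 ^+ j) <= (low_frequency_card C N f)%:R :> R].
  have [N [jN lnN NK]] := fN j; exists N; split => //.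
    (* By convention [ln 0 = 0], which is below [2^j]. *)
    rewrite ltr0n lt0n; apply/eqP => N0; move: lnN.
    by rewrite N0 ln0// leNgt pow2.
  rewrite ler_pdivrMr ?mulr_gt0// mulrC.
  by rewrite -natrX -!natrM ler_nat.
split; exists f; split => //.
- apply: (@not_cvg0 _ _ (eps / D%:R)); first by rewrite divr_gt0.
  move=> j; have [N [jN N0 lnN NK]] := NP j; exists N => //.
  have P0 : 0 < (N%:R : R) `^ eps by rewrite powR_gt0.
  (* [N^eps = exp (eps ln N) >= 1 + eps ln N]; the factor [2^j] cancels the sparsity and leaves
     [eps / D]. *)
  have NP' : eps * 2 ^+ j <= (N%:R : R) `^ eps.
    rewrite /powR gt_eqF//; apply: le_trans (expR_ge1Dx _).
    by apply: le_trans (_ : eps * ln N%:R <= _); rewrite ?ler_pM2l// lerDr.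
  rewrite ler_pdivlMr ?powR_gt0//; apply: le_trans NK.
  rewrite powRD ?(gt_eqF N0) ?implybT// powRr1// powRN.
  have -> : eps / D%:R * (N%:R / N%:R `^ eps) =
      N%:R / (D%:R * 2 ^+ j) * (eps * 2 ^+ j / N%:R `^ eps) :> R.
    by field; rewrite !gt_eqF.
  by rewrite ler_piMr ?divr_ge0 ?mulr_ge0 ?exprn_ge0// ler_pdivrMr// mul1r.
- apply: (@not_cvg0 _ _ D%:R^-1); first by rewrite invr_gt0.
  move=> j; have [N [jN N0 lnN NK]] := NP j; exists N => //.
  have ln1 : 1 <= ln (N%:R : R).
    by apply: le_trans lnN; rewrite exprn_ege1// ler1n.
  (* As [ln N >= 1], the power [1 + eps] only increases it; one factor [ln N] already offsets the
     density [1 / (D 2^j)]. *)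
  have lnP : 2 ^+ j <= ln (N%:R : R) `^ (1 + eps).
    by apply: le_trans lnN _; rewrite le1r_powR// lerDl ltW.
  rewrite ler_pdivlMr//.
  have -> : D%:R^-1 * N%:R = N%:R / (D%:R * 2 ^+ j) * 2 ^+ j :> R.
    by field; rewrite !gt_eqF.
  by rewrite ler_pM ?divr_ge0 ?mulr_ge0 ?exprn_ge0.
Qed.
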